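(* Let $H$ be an ordered graph that does not have a local barrier and let $\eta>0$. There exists $n_0\in\mathbb N$ such that if $G$ is an ordered graph on $n\geq n_0$ vertices with $\delta(G)\geq\left(1-\frac{1}{\chi_<(H)-1}+\eta\right)n$, then for every vertex $x\in V(G)$ there exists a copy of $H$ in $G$ covering $x$.
   Context: An ordered graph on $h$ vertices is a graph with vertex set $[h]$ (ordered naturally). An ordered graph $G$ on $[n]$ contains an ordered graph $H$ on $[h]$ if there is an injection $\phi:[h]\to[n]$ with $\phi(i)<\phi(j)$ for $i<j$ and $\phi(i)\phi(j)\in E(G)$ whenever $ij\in E(H)$; the image is a copy of $H$. For sets of integers, $X<Y$ means $a<b$ for all $a\in X,b\in Y$. An interval $r$-colouring of $H$ is a partition of $[h]$ into $r$ intervals $V_1<\dots<V_r$ (some possibly empty) with no edge inside an interval; $\chi_<(H)$ is the least such $r$. $H$ (with $r:=\chi_<(H)\ge 2$) has a local barrier if there exist fixed $i\neq j\in[r+1]$ such that for every interval $(r+1)$-colouring $V_1<\dots<V_{r+1}$ of $H$ with $V_i=\{v\}$ a singleton, there is at least one edge of $H$ between $v$ and $V_j$. *)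

(* Defs.v *)
From HB Require Import structures.
From mathcomp Require Import all_boot all_order all_algebra.
From mathcomp Require Import reals.

Set Implicit Arguments.
Unset Strict Implicit.
Unset Printing Implicit Defensive.

(* The vertex set [n] = {1, ..., n} is represented by 'I_n = {0, ..., n-1}. *)
Record ordered_graph (n : nat) := OrderedGraph {
  edge : rel 'I_n;
  edge_sym : symmetric edge;
  edge_irr : irreflexive edge
}.

Definition degree n (G : ordered_graph n) (x : 'I_n) : nat :=
  #|[set y | edge G x y]|.

(* Degrees are smaller than n, so the default value n does not affect the
   minimum when n > 0. *)
Definition min_degree n (G : ordered_graph n) : nat :=
  \big[minn/n]_(x < n) degree G x.

Definition is_copy h n (H : ordered_graph h) (G : ordered_graph n)
    (phi : 'I_h -> 'I_n) : Prop :=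
  [/\ injective phi,
      forall i j : 'I_h, i < j -> phi i < phi j
    & forall i j : 'I_h, edge H i j -> edge G (phi i) (phi j)].

Definition is_interval h (A : {set 'I_h}) : bool :=
  [forall x in A, forall z in A, forall y : 'I_h, (x <= y <= z) ==> (y \in A)].

Definition set_before h (A B : {set 'I_h}) : bool :=
  [forall a in A, forall b in B, a < b].

(* Disjointness of the parts follows from V_i < V_j for i < j; parts may be
   empty. *)
Definition interval_colouring h (H : ordered_graph h) r
    (V : {ffun 'I_r -> {set 'I_h}}) : bool :=
  [&& \bigcup_i V i == [set: 'I_h],
      [forall i, is_interval (V i)],
      [forall i : 'I_r, forall j : 'I_r, (i < j) ==> set_before (V i) (V j)]
    & [forall i, forall x in V i, forall y in V i, ~~ edge H x y]].

Definition interval_colourable h (H : ordered_graph h) (r : nat) : bool :=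
  [exists V : {ffun 'I_r -> {set 'I_h}}, interval_colouring H V].

Lemma interval_colourable_ex h (H : ordered_graph h) :
  exists r, interval_colourable H r.
Proof.
exists h; apply/existsP; exists [ffun i => [set i]]; apply/and4P; split.
- apply/eqP/setP=> x; rewrite in_setT; apply/bigcupP.
  by exists x => //; rewrite ffunE set11.
- apply/forallP=> i; rewrite ffunE.
  apply/forall_inP=> x /set1P->; apply/forall_inP=> z /set1P->.
  apply/forallP=> y; apply/implyP; rewrite -eqn_leq => /eqP iy.
  by rewrite inE; apply/eqP/val_inj.
- apply/forallP=> i; apply/forallP=> j; apply/implyP=> ij; rewrite !ffunE.
  by apply/forall_inP=> x /set1P->; apply/forall_inP=> z /set1P->.
- apply/forallP=> i; rewrite ffunE.
  by apply/forall_inP=> x /set1P->; apply/forall_inP=> z /set1P->; rewrite edge_irr.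
Qed.

Definition interval_chromatic_number h (H : ordered_graph h) : nat :=
  ex_minn (interval_colourable_ex H).

Definition has_local_barrier h (H : ordered_graph h) : Prop :=
  let r := interval_chromatic_number H in
  exists i j : 'I_r.+1, i != j /\
    forall (V : {ffun 'I_r.+1 -> {set 'I_h}}) (v : 'I_h),
      interval_colouring H V -> V i = [set v] ->
      exists2 w : 'I_h, w \in V j & edge H v w.

(* Main.v *)
(* Let q = chi - 1. By the degree condition, for any at most q nonempty sets a
   positive proportion of the vertices sees a positive proportion of each of
   them. Starting from {x}, one adds parts one at a time: if the earlier parts
   have bounded size, many of these vertices have the same neighbours in the
   earlier parts and the same place in the order relative to them; such vertices
   form the next part, and the earlier parts are shrunk accordingly. This gives
   {x} and q further large parts, all pairwise complete to each other; adding one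
   more part while ignoring x gives q + 1 = chi large parts, pairwise complete,
   of which only the last need not be complete to {x}. All parts are intervals
   relative to each other, so {x} and the last part have positions i and j among
   the chi + 1 parts; the interval colouring that shows that (i, j) is not a
   local barrier embeds H with its singleton class sent to x. *)
Require Import Defs.
From HB Require Import structures.
From mathcomp Require Import all_boot all_order all_algebra.
From mathcomp Require Import boolp reals.
From mathcomp Require Import zify ring lra.

Set Implicit Arguments.
Unset Strict Implicit.
Unset Printing Implicit Defensive.

Import Order.TTheory GRing.Theory Num.Theory.

(** * Complete and order-separated pairs of vertex sets *)

Definition joined n (G : ordered_graph n) (A B : {set 'I_n}) : Prop :=
  forall a b, a \in A -> b \in B -> edge G a b.

Definition separated n (A B : {set 'I_n}) : bool :=
  set_before A B || set_before B A.

Lemma set_beforeP n (A B : {set 'I_n}) :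
  reflect (forall a b, a \in A -> b \in B -> a < b) (set_before A B).
Proof.
apply: (iffP forall_inP) => [AB a b aA bB|AB a aA].
  exact: (forall_inP (AB a aA)).
by apply/forall_inP => b; apply: AB.
Qed.

Lemma joined_sym n (G : ordered_graph n) A B : joined G A B -> joined G B A.
Proof. by move=> AB b a bB aA; rewrite edge_sym; apply: AB. Qed.

Lemma separated_sym n (A B : {set 'I_n}) : separated A B = separated B A.
Proof. exact: orbC. Qed.

Lemma sub_joined n (G : ordered_graph n) (A A' B B' : {set 'I_n}) :
  A' \subset A -> B' \subset B -> joined G A B -> joined G A' B'.
Proof. by move=> /subsetP AA /subsetP BB J a b /AA aA /BB; apply: J. Qed.

Lemma sub_set_before n (A A' B B' : {set 'I_n}) :
  A' \subset A -> B' \subset B -> set_before A B -> set_before A' B'.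
Proof.
move=> /subsetP AA /subsetP BB /set_beforeP J.
by apply/set_beforeP => a b /AA aA /BB; apply: J.
Qed.

Lemma sub_separated n (A A' B B' : {set 'I_n}) :
  A' \subset A -> B' \subset B -> separated A B -> separated A' B'.
Proof.
move=> AA BB /orP[] s; apply/orP; [left|right]; exact: sub_set_before s.
Qed.

(** * Large homogeneous subsets by pigeonhole *)

Lemma exists_subset_card (T : finType) (A : {set T}) k :
  k <= #|A| -> exists2 B : {set T}, B \subset A & #|B| = k.
Proof.
move=> kA; exists [set x in take k (enum A)].
  by apply/subsetP => x; rewrite inE => /mem_take; rewrite mem_enum.
rewrite cardsE; have /card_uniqP -> : uniq (take k (enum A)).
  by rewrite take_uniq // enum_uniq.
by rewrite size_takel // -cardE.
Qed.

Lemma pigeonhole_fiber (T S : finType) (f : T -> S) (A : {set T}) (P : {set S}) t :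
  (forall v, v \in A -> f v \in P) -> t * #|P| < #|A| ->
  exists s, t < #|[set v in A | f v == s]|.
Proof.
move=> fP big; apply/existsP; apply: contraLR big => /existsPn small.
rewrite -leqNgt -sum1_card (partition_big f (mem P)) //=.
rewrite mulnC -sum_nat_const; apply: leq_sum => s _.
by rewrite sum1dep_card leqNgt small.
Qed.

(** Vertices outside [U] are classified by their neighbours in [U] and by the elements of [U] below
    them: at most [2 ^ m * 2 ^ m] classes. The summand [m] pays for discarding [U]. *)
Lemma homogeneous_subset n (G : ordered_graph n) (A U : {set 'I_n}) m t :
  #|U| <= m -> t * 4 ^ m + m < #|A| ->
  exists (v : 'I_n) (C : {set 'I_n}),
    [/\ C \subset A, v \in C, t < #|C|, forall w, w \in C -> w \notin U &
    forall w u : 'I_n, w \in C -> u \in U ->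
      edge G w u = edge G v u /\ (u < w) = (u < v)].
Proof.
move=> Um Abig.
pose f (v : 'I_n) := ([set u in U | edge G v u], [set u in U | u < v]).
have [||s] := @pigeonhole_fiber _ _ f (A :\: U) (setX (powerset U) (powerset U)) t.
- move=> v _; rewrite !inE /=.
  by apply/andP; split; apply/subsetP => u; rewrite inE => /andP[].
- rewrite cardsX card_powerset -expnMn.
  have := cardsID U A; have := subset_leq_card (subsetIr A U).
  have : t * 4 ^ #|U| <= t * 4 ^ m by rewrite leq_mul2l leq_exp2l ?Um ?orbT.
  move=> le AU AE; apply: leq_ltn_trans le _.
  rewrite -(ltn_add2r m) (leq_trans Abig) // -AE addnC leq_add2l.
  exact: leq_trans Um.
set C := [set _ in _ | _] => Cbig.
have /card_gt0P[v vC] : 0 < #|C| by apply: leq_ltn_trans Cbig.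
have CAU w : w \in C -> [/\ w \in A, w \notin U & f w = s].
  by rewrite !inE => /andP[/andP[-> ->] /eqP].
exists v, C; split => //.
- by apply/subsetP => w /CAU[].
- by move=> w /CAU[].
move=> w u wC uU; have [_ _ ws] := CAU w wC; have [_ _] := CAU v vC.
rewrite -ws; by case=> /setP/(_ u) + /setP/(_ u); rewrite !inE uU /= => -> ->.
Qed.

(** * Common neighbourhoods under the density condition *)

(* The minimum degree condition with 1/N in place of eta and q = chi - 1,
   multiplied by q * N. *)
Definition dense n (G : ordered_graph n) q N : Prop :=
  forall b, q * N * n + q * n <= q * N * degree G b + N * n.

Definition nbhd n (G : ordered_graph n) (v : 'I_n) := [set u | edge G v u].

(* Markov's inequality for the number of non-neighbours in [B]. *)
Lemma few_poorly_joined n (G : ordered_graph n) q N (B : {set 'I_n}) :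
  dense G q N -> 0 < N -> 0 < #|B| ->
  q * (#|[set v | 2 * N * #|B :&: nbhd G v| <= #|B|]| * (2 * N).-1)
    <= 2 * (N - q) * n.
Proof.
move=> dG N0 B0; set P := [set v | _].
(* Non-adjacent pairs between [P] and [B] are counted from both sides. *)
have sumE : \sum_(v in P) #|B :\: nbhd G v| <= \sum_(b in B) (n - degree G b).
  apply: leq_trans (_ : \sum_(v : 'I_n) #|B :\: nbhd G v| <= _).
    by rewrite [leqRHS](bigID (mem P)) leq_addr.
  rewrite (eq_bigr (fun v => \sum_(b in B) (~~ edge G v b : nat))); last first.
    move=> v _; rewrite -sum1_card big_mkcond [RHS]big_mkcond /=.
    by apply: eq_bigr => b _; rewrite !inE; case: (edge G v b); case: (b \in B).
  rewrite exchange_big; apply: leq_sum => b _ /=.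
  rewrite (_ : n - degree G b = #|~: nbhd G b|); last first.
    by rewrite -(addKn (degree G b) #|~: nbhd G b|) cardsC card_ord.
  rewrite -sum1_card [leqRHS]big_mkcond /=.
  by apply: leq_sum => v _; rewrite !inE edge_sym; case: (edge G b v).
have low : #|P| * ((2 * N).-1 * #|B|) <= 2 * N * \sum_(v in P) #|B :\: nbhd G v|.
  rewrite big_distrr /= -sum_nat_const; apply: leq_sum => v.
  rewrite inE => vP; have := cardsID (nbhd G v) B.
  move: (#|_ :&: _|) (#|_ :\: _|) vP => a b vP E.
  have : (2 * N).-1 * #|B| + #|B| = 2 * N * #|B| by rewrite -mulSnr prednK ?muln_gt0.
  rewrite -(leq_add2r #|B|) => ->; rewrite -{1}E mulnDr addnC leq_add2l.
  exact: vP.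
have up : q * N * (\sum_(b in B) (n - degree G b)) + #|B| * (q * n) <= #|B| * (N * n).
  rewrite -!sum_nat_const big_distrr /= -big_split /=; apply: leq_sum => b _.
  rewrite mulnBr -(leq_add2r (q * N * degree G b)) addnAC subnK; last first.
    by rewrite leq_mul2l -[X in _ <= X]card_ord max_card orbT.
  by rewrite [leqRHS]addnC; apply: dG.
suff le : q * (#|P| * (2 * N).-1) + 2 * q * n <= 2 * N * n.
  rewrite mulnBr mulnBl leq_subRL; first by rewrite addnC; exact: le.
  exact: leq_trans (leq_addl _ _) le.
rewrite -(leq_pmul2l B0).
move: (\sum_(v in P) _) (\sum_(b in B) _) sumE low up => s1 s2 s12 low up.
have : q * (#|P| * ((2 * N).-1 * #|B|)) <= q * (2 * N * s2).
  by rewrite leq_mul2l (leq_trans low) ?orbT // leq_mul2l s12 orbT.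
lia.
Qed.

(** Union bound: at most [2 * (N - 1) * n / (2 * N - 1)] vertices are poorly joined to some [D i],
    which leaves at least [n / (2 * N - 1)]. *)
Lemma many_well_joined n (G : ordered_graph n) q N k (D : nat -> {set 'I_n}) :
  dense G q N -> 0 < q -> 0 < N -> k <= q ->
  (forall i, i < k -> 0 < #|D i|) ->
  n <= 2 * N * #|[set v | [forall i : 'I_k, #|D i| < 2 * N * #|D i :&: nbhd G v|]]|.
Proof.
move=> dG q0 N0 kq D0; set A := [set v | _].
pose P (i : 'I_k) := [set v | 2 * N * #|D i :&: nbhd G v| <= #|D i|].
have cAP : #|~: A| <= \sum_(i < k) #|P i|.
  apply: leq_trans (_ : #|\bigcup_i P i| <= _); last first.
    elim/big_rec2: _ => [|i a B _ ab]; first by rewrite cards0.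
    by rewrite (leq_trans (leq_card_setU _ _)) // leq_add2l.
  apply/subset_leq_card/subsetP => v; rewrite !inE negb_forall.
  case/existsP => i; rewrite -leqNgt => vi.
  by apply/bigcupP; exists i => //; rewrite inE.
have PS : q * ((\sum_(i < k) #|P i|) * (2 * N).-1) <= q * (2 * (N - q) * n).
  rewrite big_distrl big_distrr /=.
  apply: leq_trans (_ : k * (2 * (N - q) * n) <= _); last by rewrite leq_mul2r kq orbT.
  have <- : \sum_(i < k) 2 * (N - q) * n = k * (2 * (N - q) * n).
    by rewrite sum_nat_const card_ord.
  apply: leq_sum => i _.
  by apply: few_poorly_joined => //; apply: D0.
rewrite leq_pmul2l // in PS.
have := cardsC A; rewrite card_ord => E.
have : #|~: A| * (2 * N).-1 <= 2 * N.-1 * n.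
  apply: leq_trans (leq_trans PS _); first by rewrite leq_mul2r cAP orbT.
  by rewrite leq_mul2r leq_mul2l; apply/orP; right; lia.
move: (#|A|) (#|~: A|) E => a b <-; case: (N) N0 => // M _; nia.
Qed.

(** A homogeneous set [C] of well-joined vertices has the same neighbours in [U] as one
    representative [v], so [D i :&: nbhd G v] is complete to [C]. Of the factor [4 * N], [2 * N]
    comes from well-joinedness and 2 from choosing a side of [C]. [U] may exceed the union of the
    [D i], so that [C] can be separated from a vertex without being joined to it. *)
Lemma extend_family q N m t : 0 < q -> 0 < N ->
  exists n0, forall n (G : ordered_graph n) k (D : nat -> {set 'I_n}) (U : {set 'I_n}),
  n0 <= n -> dense G q N -> k <= q -> #|U| <= m ->
  (forall i, i < k -> 0 < #|D i| /\ D i \subset U) ->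
  exists C : {set 'I_n}, [/\ t < #|C|,
    forall u, u \in U -> separated [set u] C &
    forall i, i < k -> exists B : {set 'I_n},
      [/\ B \subset D i, joined G B C, separated B C & #|D i| < 4 * N * #|B|]].
Proof.
move=> q0 N0; exists (2 * N * (t * 4 ^ m + m)).+1 => n G k D U nbig dG kq Um DU.
have := many_well_joined dG q0 N0 kq (fun i ik => (DU i ik).1).
set A := [set v | _] => Abig.
have [|v [C [CA vC Ct CU homC]]] := @homogeneous_subset n G A U m t Um.
  by have := leq_trans nbig Abig; rewrite ltn_pmul2l // muln_gt0.
exists C; split => // [u uU|i ik].
  apply/orP; case: (ltngtP u v) => [uv|vu|/val_inj uv].
  - left; apply/set_beforeP => a b /set1P -> bC.
    by rewrite (homC _ _ bC uU).2.
  - right; apply/set_beforeP => a b aC /set1P ->.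
    have [_ E] := homC _ _ aC uU; rewrite ltnNge leq_eqVlt E negb_or -leqNgt (ltnW vu) andbT.
    by apply: contraTneq aC => /val_inj <-; apply/negP => /CU; rewrite uU.
  - by have := CU _ vC; rewrite -uv uU.
have [Di0 /subsetP DiU] := DU i ik.
set W := D i :&: nbhd G v; pose Z := [set u : 'I_n | u < v].
have DW : #|D i| < 2 * N * #|W|.
  have /(subsetP CA) := vC; rewrite inE => /forallP/(_ (Ordinal ik)).
  by [].
have WJ : joined G W C.
  move=> u w /setIP[uD]; rewrite inE => vu wC.
  by rewrite edge_sym (homC _ _ wC (DiU _ uD)).1.
have sWD : W \subset D i by apply: subsetIl.
(* The order cut of [C] splits [W] in two; the larger half is separated from [C]. *)
have [le|le] := leqP #|W :\: Z| #|W :&: Z|.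
  exists (W :&: Z); split.
  - exact: subset_trans (subsetIl _ _) sWD.
  - exact: sub_joined (subsetIl _ _) (subxx _) WJ.
  - apply/orP; left; apply/set_beforeP => u w /setIP[/(subsetP sWD) uD].
    by rewrite inE => uv wC; rewrite (homC _ _ wC (DiU _ uD)).2.
  - apply: leq_trans DW _; rewrite -(cardsID Z W) (_ : 4 * N = 2 * N * 2); last by lia.
    by rewrite -[2 * N * 2 * _]mulnA [2 * #|_|]mul2n -addnn leq_pmul2l ?muln_gt0 // leq_add2l.
exists (W :\: Z); split.
- exact: subset_trans (subsetDl _ _) sWD.
- exact: sub_joined (subsetDl _ _) (subxx _) WJ.
- apply/orP; right; apply/set_beforeP => w u wC /setDP[/(subsetP sWD) uD].
  rewrite inE => uv.
  have [_ E] := homC _ _ wC (DiU _ uD).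
  rewrite ltnNge leq_eqVlt E (negPf uv) orbF.
  by apply: contraTneq wC => /val_inj <-; apply/negP => /CU; rewrite DiU.
- apply: leq_trans DW _; rewrite -(cardsID Z W) (_ : 4 * N = 2 * N * 2); last by lia.
  by rewrite -[2 * N * 2 * _]mulnA [2 * #|_|]mul2n -addnn leq_pmul2l ?muln_gt0 // leq_add2r ltnW.
Qed.

(** * Growing a family of pairwise complete parts around [x] *)

Definition clique_family n (G : ordered_graph n) (x : 'I_n) t k
    (D : nat -> {set 'I_n}) : Prop :=
  [/\ D 0 = [set x],
      forall i, 0 < i <= k -> #|D i| = t
    & forall i j, i < j <= k -> joined G (D i) (D j) /\ separated (D i) (D j)].

Lemma sub_clique_family n (G : ordered_graph n) (x : 'I_n) t T k D D' :
  clique_family G x T k D -> D' 0 = [set x] ->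
  (forall i, i <= k -> D' i \subset D i) ->
  (forall i, 0 < i <= k -> #|D' i| = t) -> clique_family G x t k D'.
Proof.
case=> _ _ jD D'0 sD cD; split=> // i j /[dup] /andP[ij jk] /jD[J S].
have si := sD i (leq_trans (ltnW ij) jk); have sj := sD j jk.
by split; [apply: sub_joined J | apply: sub_separated S].
Qed.

(* With [s = 0] the new set [C] is joined to [x] as well, which costs one more
   neighbourhood in the union bound; with [s = 1] it is only separated from [x]. *)
Lemma refine_clique_family q N k t s : 0 < q -> 0 < N -> k < q + s -> s <= 1 ->
  exists n0, forall n (G : ordered_graph n) (x : 'I_n) D,
  n0 <= n -> dense G q N -> clique_family G x (4 * N * t).+1 k D ->
  exists D' (C : {set 'I_n}), [/\ clique_family G x t k D', #|C| = t,
    forall i, i <= k -> separated (D' i) C &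
    forall i, s <= i <= k -> joined G (D' i) C].
Proof.
(* [T] is large enough to leave [t] vertices after the loss of a factor [4 * N]. *)
move=> q0 N0 kq s1; pose T := (4 * N * t).+1.
have [n0 ext] := extend_family (k.+1 * T) t q0 N0.
exists n0 => n G x D nbig dG famD; have [D0 Dt Dj] := famD.
have Dle i : i <= k -> 0 < #|D i| <= T.
  by case: i => [|i] ik; [rewrite D0 cards1 | rewrite Dt ?leqnn].
pose U := \bigcup_(i < k.+1) D i.
have DU i : i <= k -> D i \subset U.
  by rewrite -ltnS => ik; rewrite (bigcup_sup (Ordinal ik)).
have UT : #|U| <= k.+1 * T.
  apply: leq_trans (_ : \sum_(i < k.+1) T <= _); last by rewrite sum_nat_const card_ord.
  rewrite /U; elim/big_rec2: _ => [|i a B _ ab]; first by rewrite cards0.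
  rewrite (leq_trans (leq_card_setU _ _)) // leq_add //.
  by have /andP[] := Dle i (ltn_ord i).
(* The shift by [s] omits part 0 when [s = 1]; in both cases at most [q] sets enter the union
   bound. *)
have [||C [Ct sepC extC]] := ext n G (k.+1 - s) (fun i => D (i + s)) U nbig dG _ UT.
- by lia.
- move=> i ik; have ik' : i + s <= k by lia.
  by have /andP[-> _] := Dle _ ik'; rewrite DU.
have {}extC i : s <= i <= k -> exists B : {set 'I_n},
    [/\ B \subset D i, joined G B C, separated B C & #|D i| < 4 * N * #|B|].
  move=> /andP[si ik]; have [|B] := extC (i - s); first by lia.
  by rewrite subnK //; exists B.
have [C' sC' cC'] := exists_subset_card (ltnW Ct).
have /choice[D' D'P] : forall i, exists B : {set 'I_n}, i <= k ->
    [/\ B \subset D i, i = 0 -> B = [set x], 0 < i -> #|B| = t,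
        separated B C' & s <= i -> joined G B C'].
  move=> i; have [ik|] := leqP i k; last by exists set0.
  have [i0|i0] := posnP i.
    exists [set x]; split=> //; first by rewrite i0 D0.
      apply: sub_separated (subxx _) sC' (sepC _ _).
      by apply: (subsetP (DU 0 _)); rewrite // D0 set11.
    move=> si; have [|B [sB jB _ cB]] := extC i; first by rewrite si.
    (* The size bound makes [B] nonempty, so the one-vertex part cannot shrink. *)
    suff <- : B = [set x] by apply: sub_joined jB.
    apply/eqP; rewrite eqEcard -{1}D0 -i0 sB cards1 /=.
    by case: #|B| cB; rewrite ?muln0.
  have [|B [sB jB SB cB]] := extC i; first by rewrite (leq_trans s1).
  have [|B' sB' cB'] := @exists_subset_card _ B t.
    have iD : #|D i| = T by rewrite Dt ?i0.
    by move: cB; rewrite iD => /ltnW/ltnW; rewrite leq_pmul2l ?muln_gt0.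
  exists B'; split => //; first exact: subset_trans sB.
  - by move=> ii; rewrite ii in i0.
  - exact: sub_separated SB.
  - by move=> _; apply: sub_joined jB.
exists D', C'; split => //.
- apply: (sub_clique_family famD).
  + by have [//|_ ->] := D'P 0.
  + by move=> i /D'P[].
  + by move=> i /andP[i0 /D'P[_ _ ->]].
- by move=> i /D'P[].
- by move=> i /andP[si /D'P[_ _ _ _]]; apply.
Qed.

(** Induction on [k] for all [t] at once, since each new part requires larger earlier parts. *)
Lemma exists_clique_family q N k : 0 < q -> 0 < N -> k <= q -> forall t,
  exists n0, forall n (G : ordered_graph n) (x : 'I_n),
  n0 <= n -> dense G q N -> exists D, clique_family G x t k D.
Proof.
move=> q0 N0; elim: k => [|k IH] kq t.
  exists 0 => n G x _ _; exists (fun=> [set x]).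
  by split => // [[|i]|i [|j]] //=; rewrite andbF.
have [n1 fam] := IH (ltnW kq) (4 * N * t).+1.
have [|n2 ref] := @refine_clique_family q N k t 0 q0 N0 _ isT; first by rewrite addn0.
exists (maxn n1 n2) => n G x; rewrite geq_max => /andP[nn1 nn2] dG.
have [D0 famD0] := fam n G x nn1 dG.
have [D [C [[Dx Dt Dj] Ct sC jC]]] := ref n G x D0 nn2 dG famD0.
exists (fun i => if i <= k then D i else C); split => //.
- by move=> i /andP[i0 _]; case: ifP => // ik; rewrite Dt ?i0.
move=> i j /andP[ij jk]; have ik : i <= k by rewrite -ltnS (leq_trans ij).
rewrite ik; case: ifP => jk'; first by apply: Dj; rewrite ij.
by split; [apply: jC | apply: sC].
Qed.

(** * Embedding [H] into the ordered parts *)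

(* The parts sit in a fixed relative order, which determines the positions
   [i] of [x] and [j] of the exceptional part fed to the barrier condition. *)
Lemma embedding_of_parts h (H : ordered_graph h) r n (G : ordered_graph n)
    (x : 'I_n) (E : 'I_r.+1 -> {set 'I_n}) (p0 p1 : 'I_r.+1) :
  interval_chromatic_number H = r ->
  ~ has_local_barrier H -> p0 != p1 -> E p0 = [set x] ->
  (forall p : 'I_r.+1, p != p0 -> h < #|E p|) ->
  (forall p p' : 'I_r.+1, p != p' -> separated (E p) (E p')) ->
  (forall p p' : 'I_r.+1, p != p' -> [set p; p'] != [set p0; p1] -> joined G (E p) (E p')) ->
  exists2 phi : 'I_h -> 'I_n, is_copy H G phi & exists i : 'I_h, phi i = x.
Proof.
move=> Er nobar p01 E0 Ebig Esep Ejoin.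
have Ene p : exists a, a \in E p.
  apply/set0Pn; rewrite -card_gt0; have [->|/Ebig] := eqVneq p p0.
    by rewrite E0 cards1.
  exact: leq_ltn_trans.
have before_irr (A B : {set 'I_n}) : (exists a, a \in A) -> (exists b, b \in B) ->
    set_before A B -> ~~ set_before B A.
  move=> [a aA] [b bB] /set_beforeP AB; apply/negP => /set_beforeP BA.
  by have := ltn_trans (AB _ _ aA bB) (BA _ _ bB aA); rewrite ltnn.
(* [set_before] is a strict total order on the nonempty, separated parts. The number of earlier
   parts is thus a bijective rank, whose inverse [tau] lists the parts in order. *)
pose S p := [set p' | set_before (E p') (E p)].
have Sirr p : p \notin S p.
  by rewrite inE; apply/negP => b; have := before_irr _ _ (Ene p) (Ene p) b; rewrite b.
have Sr p : #|S p| < r.+1.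
  by rewrite -[X in _ < X]card_ord -cardsT; apply: proper_card; rewrite properT;
     apply: contraNneq (Sirr p) => ->.
pose rk p := Ordinal (Sr p).
have rk_lt p p' : set_before (E p) (E p') -> rk p < rk p'.
  move=> b; apply: proper_card; apply/properP; split; last first.
    by exists p; rewrite ?Sirr // inE.
  apply/subsetP => p''; rewrite !inE => b'; have [c cE] := Ene p.
  apply/set_beforeP => a d aE dE.
  exact: ltn_trans (set_beforeP _ _ b' a c aE cE) (set_beforeP _ _ b c d cE dE).
have rk_inj : injective rk.
  move=> p p' E1; apply/eqP; apply: contraT => /Esep/orP[] /rk_lt;
  by rewrite E1 ltnn.
pose tau : 'I_r.+1 -> 'I_r.+1 := invF rk_inj.
have tau_inj : injective tau := can_inj (f_invF rk_inj).
have tau_before (a b : 'I_r.+1) : a < b -> set_before (E (tau a)) (E (tau b)).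
  move=> ab; have /Esep/orP[//|/rk_lt] : tau a != tau b.
    by apply/eqP => /tau_inj ab'; rewrite ab' ltnn in ab.
  by rewrite !f_invF ltnNge (ltnW ab).
have [i Di] : exists i, tau i = p0 by exists (rk p0); apply: invF_f.
have [j Dj] : exists j, tau j = p1 by exists (rk p1); apply: invF_f.
apply: contrapT => nocopy; apply: nobar; rewrite /has_local_barrier Er.
exists i, j; split.
  by apply: contraNneq p01 => ij; rewrite -Di -Dj ij.
move=> V v Vcol Vi; have [/exists_inP//|/exists_inPn noedge] :=
  boolP [exists w in V j, edge H v w].
case: nocopy; case/and4P: Vcol => /eqP Vcov _ /forallP Vord /forallP Vind.
have /choice[c cV] : forall y, exists k : 'I_r.+1, y \in V k.
  move=> y; have : y \in \bigcup_k V k by rewrite Vcov inE.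
  by case/bigcupP => k; exists k.
have c_i y : c y = i -> y = v.
  by move=> cy; have := cV y; rewrite cy Vi => /set1P.
have c_mono (y z : 'I_h) : y < z -> c y <= c z.
  move=> yz; rewrite leqNgt; apply/negP => cc.
  have /set_beforeP := implyP (forallP (Vord (c z)) (c y)) cc.
  by move/(_ z y (cV z) (cV y)); rewrite ltnNge (ltnW yz).
(* Using [y] itself as index keeps the order within a class, and [h < #|E p|] keeps it in range. For
   the part [[set x]] the default value [x] is correct at every index. *)
pose phi y := nth x (enum (E (tau (c y)))) (y : 'I_h).
have phi_mem y : phi y \in E (tau (c y)).
  have [cy|cy] := eqVneq (tau (c y)) p0.
    by rewrite /phi cy E0 enum_set1; case: (y : nat) => [|[|?]]; rewrite set11.
  by rewrite -mem_enum mem_nth // -cardE (ltn_trans _ (Ebig _ cy)).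
have sorted_enum (A : {set 'I_n}) : sorted ltn [seq val u | u <- enum A].
  rewrite /(enum _) -enumT; apply: (subseq_sorted ltn_trans) (iota_ltn_sorted 0 n).
  by rewrite -val_enum_ord map_subseq // filter_subseq.
have phi_mono (y z : 'I_h) : y < z -> phi y < phi z.
  move=> yz; have := c_mono _ _ yz; rewrite leq_eqVlt => /predU1P[/val_inj cyz|]; last first.
    by move/tau_before/set_beforeP; apply.
  have [cy|cy] := eqVneq (tau (c y)) p0.
    have Ec : c y = i by apply: tau_inj; rewrite cy Di.
    by move: yz; rewrite (c_i _ Ec) (c_i z) ?ltnn // -cyz.
  have sz : z < size (enum (E (tau (c y)))) by rewrite -cardE (ltn_trans _ (Ebig _ cy)).
  have sy := ltn_trans yz sz.
  rewrite /phi -cyz -!(nth_map x (val x) val) //.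
  by apply: (sorted_ltn_nth ltn_trans); rewrite ?inE ?size_map.
have edge_phi v' z : edge H v' z -> edge G (phi v') (phi z).
  move=> e; apply: (Ejoin (tau (c v')) (tau (c z))) => //.
    apply: contraTneq e => /tau_inj Ec.
    have := Vind (c v') => /forall_inP/(_ _ (cV v'))/forall_inP; apply.
    by rewrite Ec.
  (* Only [E p0] and [E p1] may fail to be joined; an edge of [H] between their classes would join
     [v] to [V j]. *)
  have noe a b : edge H a b -> tau (c a) = p0 -> tau (c b) = p1 -> False.
    move=> e' Ea Eb; have Ec : c a = i by apply: tau_inj; rewrite Ea.
    have Ed : c b = j by apply: tau_inj; rewrite Eb.
    have := cV b; rewrite Ed => /noedge; rewrite -(c_i _ Ec) e'.
    by [].
  apply/eqP => Eset.
  have : p0 \in [set tau (c v'); tau (c z)] by rewrite Eset set21.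
  have : p1 \in [set tau (c v'); tau (c z)] by rewrite Eset set22.
  move=> /set2P[]P1 /set2P[]P0; first by rewrite P0 P1 eqxx in p01.
  - by apply: (noe z v'); rewrite 1?edge_sym.
  - by apply: (noe v' z).
  - by rewrite P0 P1 eqxx in p01.
exists phi; last first.
  exists v; have vi : v \in V i by rewrite Vi set11.
  have ord (a b : 'I_r.+1) : a < b -> v \in V a -> v \in V b -> False.
    move=> ab va vb.
    have /set_beforeP/(_ v v va vb) := implyP (forallP (Vord a) b) ab.
    by rewrite ltnn.
  have cv : c v = i.
    by apply: val_inj; case: (ltngtP (c v) i) => // /ord; case; rewrite ?cV.
  by have := phi_mem v; rewrite cv Di E0 => /set1P.
split => //.
move=> y z Ephi; apply: val_inj; case: (ltngtP y z) => // /phi_mono; by rewrite Ephi ltnn.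
Qed.

(** * The real degree condition and the choice of parameters *)

Lemma min_degree_le n (G : ordered_graph n) b : min_degree G <= degree G b.
Proof.
rewrite /min_degree; have := mem_index_enum b.
elim: (index_enum _) => // a s IH; rewrite inE big_cons geq_min.
by case/predU1P => [->|/IH ->]; rewrite ?leqnn ?orbT.
Qed.

Local Open Scope ring_scope.

(** Multiplying by [q * N] turns the [eta] term into [q * n * (eta * N)], which is at least
    [q * n]. *)
Lemma dense_of_min_degree (R : realType) n (G : ordered_graph n) (q N : nat) (eta : R) :
  (0 < q)%N -> 1 <= eta * N%:R ->
  (1 - 1 / q%:R + eta) * n%:R <= (min_degree G)%:R -> dense G q N.
Proof.
move=> q0 etaN deg b.
have q0R : 0 < q%:R :> R by rewrite ltr0n.
have {deg} le : (1 - 1 / q%:R + eta) * n%:R <= (degree G b)%:R.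
  by apply: le_trans deg _; rewrite ler_nat min_degree_le.
rewrite -(ler_nat R) !natrD !natrM.
have qN0 : 0 <= q%:R * N%:R :> R by rewrite mulr_ge0.
have := ler_wpM2l qN0 le.
have -> : q%:R * N%:R * ((1 - 1 / q%:R + eta) * n%:R)
    = q%:R * N%:R * n%:R - N%:R * n%:R + (q%:R * n%:R) * (eta * N%:R) :> R.
  by field; rewrite gt_eqF.
have qn0 : 0 <= q%:R * n%:R :> R by rewrite mulr_ge0.
have := ler_wpM2l qn0 etaN; lra.
Qed.

Theorem theorem10p1 (R : realType) (h : nat) (H : ordered_graph h) (eta : R)
    (chi_ge2 : (2 <= interval_chromatic_number H)%N)
    (no_barrier : ~ has_local_barrier H)
    (eta_gt0 : 0 < eta) :
  exists n0 : nat, forall (n : nat) (G : ordered_graph n),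
    (n0 <= n)%N ->
    (min_degree G)%:R >=
      (1 - 1 / ((interval_chromatic_number H)%:R - 1) + eta) * n%:R ->
    forall x : 'I_n,
      exists2 phi : 'I_h -> 'I_n, is_copy H G phi & exists i : 'I_h, phi i = x.
Proof.
have [q q0 Eq] : exists2 q, (0 < q)%N & interval_chromatic_number H = q.+1.
  by case: (interval_chromatic_number H) chi_ge2 => // q; exists q.
rewrite Eq -natr1 addrK.
have eta_inv0 : 0 <= eta^-1 by rewrite invr_ge0 ltW.
have := archi_boundP eta_inv0; set N := Num.bound _ => etaN.
have N0 : (0 < N)%N by rewrite -(ltr0n R) (le_lt_trans _ etaN).
have {}etaN : 1 <= eta * N%:R by rewrite -ler_pdivrMl // mulr1 ltW.
(* The embedding needs parts with more than [h] vertices; this is the size from which one refinement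
   leaves [h.+1]. *)
have [n1 fam] := exists_clique_family q0 N0 (leqnn q) (4 * N * h.+1).+1.
have [|n2 ref] := @refine_clique_family q N q h.+1 1 q0 N0 _ isT; first by rewrite addn1.
exists (maxn n1 n2) => n G; rewrite geq_max => /andP[nn1 nn2] deg x.
have dG := dense_of_min_degree q0 etaN deg.
have [D0 famD0] := fam n G x nn1 dG.
have [D [C [[Dx Dt Dj] Ct sC jC]]] := ref n G x D0 nn2 dG famD0.
(* Index 0 is [[set x]] and index [q.+1] is [C], the only pair not known to be joined. *)
pose E (p : 'I_q.+2) := if (p <= q)%N then D p else C.
have Elt (p p' : 'I_q.+2) : (p < p')%N ->
    separated (E p) (E p') /\ ((0 < p)%N || (p' < q.+1)%N -> joined G (E p) (E p')).
  move=> pp'; have pq : (p <= q)%N by have := ltn_ord p'; lia.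
  rewrite /E pq; case: ifP => p'q; first by have [] := Dj p p'; rewrite ?pp'.
  by split; [exact: sC | rewrite ltnS p'q orbF => p0; apply: jC; rewrite p0].
apply: (@embedding_of_parts h H q.+1 n G x E ord0 ord_max) => //.
- move=> p p0; rewrite /E; case: ifP => pq; last by rewrite Ct.
  by rewrite Dt // pq lt0n p0.
- move=> p p' pp'; case: (ltngtP p p') => [/Elt[]//||/val_inj E1]; last by rewrite E1 eqxx in pp'.
  by rewrite separated_sym => /Elt[].
have key (p p' : 'I_q.+2) : (p < p')%N -> [set p; p'] != [set ord0; ord_max] ->
    joined G (E p) (E p').
  move=> /Elt[_ J] ne; apply: J; apply: contraNT ne; rewrite negb_or -!leqNgt leqn0.
  move=> /andP[/eqP p0 p'q].
  have -> : p = ord0 by apply: val_inj.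
  suff -> : p' = ord_max by [].
  by apply: val_inj; apply/eqP; rewrite eqn_leq -ltnS ltn_ord.
move=> p p' pp' ne; case: (ltngtP p p') => [/key||/val_inj E1]; first exact.
- by move=> /key J; apply: joined_sym; apply: J; rewrite setUC.
- by rewrite E1 eqxx in pp'.
Qed.
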